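(* Let $m,n$ be positive integers, $I=\{1,\dots,m\}$, $J=\{1,\dots,n\}$, let $A=(a_{ij})$ be an $m\times n$ matrix with entries in $[0,1]$ and let $b=(b_i)\in[0,1]^m$. Then $S(A,b)=\bigcup_{e\in\bar{E}}[\underline{X}(e),\bar{X}]$.
   Context: $T_L(x,y)=\max\{x+y-1,0\}$ is the Lukasiewicz t-norm. The feasible set is $S(A,b)=\{x\in[0,1]^n:\ \max_{j=1}^n T_L(a_{ij},x_j)=b_i \text{ for all } i\in I\}$. For vectors $u,v\in[0,1]^n$, $[u,v]=\{x\in[0,1]^n: u\le x\le v\}$ with the componentwise order. For $i\in I$ let $J_i=\{j\in J: a_{ij}\ge b_i\}$. The vector $\bar X\in[0,1]^n$ is the componentwise minimum $\bar{X}=\min_{i\in I}\hat{x}_i$, where $(\hat{x}_i)_j=b_i+1-a_{ij}$ if $j\in J_i$, and $(\hat{x}_i)_j=1$ if $j\notin J_i$. For $i\in I$ let $\bar J_i=\{j\in J_i: T_L(a_{ij},\bar X_j)=b_i\}$. $\bar E$ is the set of all functions $e:I\to\bigcup_{i\in I}\bar J_i$ with $e(i)\in\bar J_i$ for every $i\in I$. For $i\in I$ and $j\in J_i$, the vector $\check{x}_i(j)$ is defined by $\check{x}_i(j)_k=b_i+1-a_{ij}$ if $b_i\ne 0$ and $k=j$, and $\check{x}_i(j)_k=0$ otherwise ($k\in J$). For a function $e$ on $I$ with $e(i)\in J_i$ for all $i\in I$, $\underline{X}(e)\in[0,1]^n$ is defined by $\underline{X}(e)_j=\max_{i\in I}\check{x}_i(e(i))_j$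 for $j\in J$. *)

(* Defs.v *)
From HB Require Import structures.
From mathcomp Require Import all_boot all_order all_algebra.
From mathcomp Require Import all_classical all_reals.

Set Implicit Arguments.
Unset Strict Implicit.
Unset Printing Implicit Defensive.

Import Order.TTheory GRing.Theory Num.Theory.

Local Open Scope classical_set_scope.
Local Open Scope ring_scope.

(* Points of R^n are row vectors; the right-hand side b is a column vector, so
   that its i-th entry is [b i 0]. *)
Section MaxLukasiewicz.
Context {R : realType}.

Definition in01 (x : R) : Prop := 0 <= x <= 1.

Definition unit_cube (n : nat) : set 'rV[R]_n :=
  [set x | forall j, in01 (x 0 j)].

Definition box (n : nat) (u v : 'rV[R]_n) : set 'rV[R]_n :=
  [set x | unit_cube x /\ forall j, u 0 j <= x 0 j <= v 0 j].

Definition TL (x y : R) : R := Num.max (x + y - 1) 0.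

Context {m n : nat}.
Implicit Types (A : 'M[R]_(m, n)) (b : 'cV[R]_m).

(* The neutral element 0 does not alter the maximum when n > 0, since
   TL >= 0. *)
Definition feasible A b : set 'rV[R]_n :=
  [set x | unit_cube x /\
           forall i, \big[Num.max/0]_(j < n) TL (A i j) (x 0 j) = b i 0].

Definition Jset A b (i : 'I_m) : {set 'I_n} :=
  [set j : 'I_n | b i 0 <= A i j]%SET.

Definition xhat A b (i : 'I_m) : 'rV[R]_n :=
  \row_(j < n) (if j \in Jset A b i then b i 0 + 1 - A i j else 1).

(* The neutral element 1 does not alter the minimum when m > 0, since all
   entries of the vectors xhat are <= 1. *)
Definition Xbar A b : 'rV[R]_n :=
  \row_(j < n) \big[Num.min/1]_(i < m) xhat A b i 0 j.

Definition Jbar A b (i : 'I_m) : {set 'I_n} :=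
  [set j : 'I_n in Jset A b i | TL (A i j) (Xbar A b 0 j) == b i 0]%SET.

(* The codomain is all of 'I_n instead of the union of the sets Jbar; the
   membership condition selects the same functions. *)
Definition Ebar A b : set {ffun 'I_m -> 'I_n} :=
  [set e : {ffun 'I_m -> 'I_n} | forall i, e i \in Jbar A b i].

(* Only meaningful for j \in Jset A b i. *)
Definition xcheck A b (i : 'I_m) (j : 'I_n) : 'rV[R]_n :=
  \row_(k < n) (if (b i 0 != 0) && (k == j) then b i 0 + 1 - A i j else 0).

(* Only meaningful when e i \in Jset A b i for all i.  For A, b with entries in
   [0, 1] the entries of the vectors xcheck are then >= 0 (as A i j <= 1), so the
   neutral element 0 does not alter the maximum when m > 0. *)
Definition Xunder A b (e : {ffun 'I_m -> 'I_n}) : 'rV[R]_n :=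
  \row_(j < n) \big[Num.max/0]_(i < m) xcheck A b i (e i) 0 j.

End MaxLukasiewicz.

(* Main.v *)
(* Since TL a is residuated, x <= Xbar says exactly that TL (a_ij, x_j) <= b_i
   for all i, j.  Such an x is feasible iff for each i some e(i) attains
   TL (a_ij, x_j) >= b_i, which is void when b_i = 0 and otherwise means
   x_(e(i)) >= b_i + 1 - a_(i,e(i)); these lower bounds together say
   Xunder e <= x.  An index attaining the maximum at x also attains b_i at Xbar,
   by monotonicity, hence lies in Jbar i. *)
Require Import Defs.
From HB Require Import structures.
From mathcomp Require Import all_boot all_order all_algebra.
From mathcomp Require Import all_classical all_reals.
From mathcomp Require Import lra.

Import Order.TTheory GRing.Theory Num.Theory.

Local Open Scope classical_set_scope.
Local Open Scope ring_scope.

Lemma TL_ge0 {R : realType} (a x : R) : 0 <= TL a x.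
Proof. by rewrite le_max lexx orbT. Qed.

(* [fun x => c + 1 - a] is the residuum of [TL a], up to truncation at 1. *)
Lemma TL_le {R : realType} (a x c : R) :
  0 <= c -> (TL a x <= c) = (x <= c + 1 - a).
Proof. by move=> c0; rewrite ge_max c0 andbT; apply/idP/idP => ?; lra. Qed.

(** For positive [c] the branch 0 of the maximum cannot reach [c]. At [c = 0] the left side always
    holds, hence the strict inequality. *)
Lemma le_TL {R : realType} (a x c : R) :
  0 < c -> (c <= TL a x) = (c + 1 - a <= x).
Proof.
by move=> c0; rewrite le_max [c <= 0]leNgt c0 orbF; apply/idP/idP => ?; lra.
Qed.

Lemma TL_le_l {R : realType} (a x : R) : 0 <= a -> x <= 1 -> TL a x <= a.
Proof. by move=> a0 x1; rewrite TL_le //; lra. Qed.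

Lemma le_TL_r {R : realType} (a x y : R) : x <= y -> TL a x <= TL a y.
Proof.
by move=> xy; rewrite ge_max TL_ge0 andbT le_max; apply/orP; left; lra.
Qed.

Section SolutionSet.
Context {R : realType} {m n : nat}.
Variables (A : 'M[R]_(m, n)) (b : 'cV[R]_m).
Hypotheses (A01 : forall i j, in01 (A i j)) (b01 : forall i, in01 (b i 0)).

Lemma Xbar_le1 j : Xbar A b 0 j <= 1.
Proof. by rewrite mxE bigmin_le_id. Qed.

(** For [j] in [Jset A b i] this is residuation. Otherwise [A i j < b i 0], so every [t <= 1] meets
    the constraint, in accordance with the default 1 in [xhat]. *)
Lemma le_XbarP (t : R) j : t <= 1 ->
  reflect (forall i, TL (A i j) t <= b i 0) (t <= Xbar A b 0 j).
Proof.
move=> t1; rewrite mxE; apply: (iffP idP) => [/bigmin_geP[_ tx] i | TLb].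
  have /andP[b0 _] := b01 i; rewrite TL_le //.
  have := tx i isT; rewrite mxE inE; case: ifP => // /negbT; rewrite -ltNge.
  by move=> ? _; lra.
apply/bigmin_geP; split=> // i _; rewrite mxE; case: ifP => // _.
by have /andP[b0 _] := b01 i; rewrite -TL_le.
Qed.

Lemma feasible_sub x : (0 < n)%N -> feasible A b x ->
  exists2 e, Ebar A b e & box (Xunder A b e) (Xbar A b) x.
Proof.
move=> n_gt0 [x01 xb].
have TLb i j : TL (A i j) (x 0 j) <= b i 0 by rewrite -xb; exact: le_bigmax.
have xX j : x 0 j <= Xbar A b 0 j by apply/le_XbarP => //; case/andP: (x01 j).
have attained i : exists j, TL (A i j) (x 0 j) = b i 0.
  (* [n_gt0] supplies the default index; the neutral element 0 is harmless because [TL] is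
     nonnegative. *)
  exists [arg max_(j > Ordinal n_gt0) TL (A i j) (x 0 j)]%O.
  by rewrite -xb (bigmax_eq_arg _ (Ordinal n_gt0)) // => j _; exact: TL_ge0.
have [f fb] := choice attained; exists [ffun i => f i].
  move=> i; rewrite ffunE !inE -{1}fb.
  (* At column [f i], [b i 0] is a value of [TL (A i (f i))], hence at most [A i (f i)]; the value
     at [Xbar] is squeezed between the one at [x] and [b i 0]. *)
  have /andP[A0 _] := A01 i (f i); have /andP[_ x1] := x01 (f i).
  rewrite TL_le_l //= eq_le -{2}fb le_TL_r // andbT.
  by have /le_XbarP := lexx (Xbar A b 0 (f i)); apply; exact: Xbar_le1.
split=> // j; rewrite xX andbT mxE; have /andP[x0 _] := x01 j.
apply/bigmax_leP; split=> // i _; rewrite mxE ffunE.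
case: ifP => // /andP[b_neq0 /eqP->].
have /andP[b_ge0 _] := b01 i.
by rewrite -le_TL ?fb // lt_neqAle eq_sym b_neq0.
Qed.

Lemma box_sub e x : box (Xunder A b e) (Xbar A b) x -> feasible A b x.
Proof.
move=> [x01 xX]; split=> // i.
have /andP[b_ge0 _] := b01 i; apply/le_anti/andP; split.
  apply/bigmax_leP; split=> // j _; have /andP[_ x1] := x01 j.
  by have /andP[_ /le_XbarP] := xX j; apply.
apply: le_trans (le_bigmax _ _ (e i)).
have [->|b_neq0] := eqVneq (b i 0) 0; first exact: TL_ge0.
rewrite le_TL; last by rewrite lt_neqAle eq_sym b_neq0.
(* Among the bounds collected in [Xunder A b e] at column [e i], row [i] contributes the one
   wanted. *)
have /andP[+ _] := xX (e i); rewrite mxE => /bigmax_leP[_ /(_ i isT)].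
by rewrite mxE b_neq0 eqxx.
Qed.

End SolutionSet.

Theorem corollary4 (R : realType) (m n : nat) (m_gt0 : (0 < m)%N)
    (n_gt0 : (0 < n)%N) (A : 'M[R]_(m, n)) (b : 'cV[R]_m)
    (A01 : forall i j, in01 (A i j)) (b01 : forall i, in01 (b i 0)) :
  feasible A b = \bigcup_(e in Ebar A b) box (Xunder A b e) (Xbar A b).
Proof.
apply/seteqP; split=> x; first exact: feasible_sub.
by case=> e _; exact: box_sub.
Qed.
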